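(* For $n\ge0$ set $r_n(q)=\dfrac{\widehat F^{(n)}_1(q)}{\widehat F^{(n)}_0(q)}$, so $r_0(q)=0$. Then for every $n\ge1$ the linear-fractional recurrence $$r_n(q)=G_n\bigl(r_{n-1}(q)\bigr),\qquad G_n(x):=\frac{q^n+(1-q^n)x}{1+q^nx},$$ holds. Equivalently, $r_n$ is given by the explicit finite nested continued fraction $$r_n(q)=G_n\Bigl(G_{n-1}\bigl(\cdots G_2\bigl(\tfrac{q}{1}\bigr)\cdots\bigr)\Bigr),$$ where the innermost term $\frac q1$ equals $G_1(0)$ (so $r_1(q)=q$). Moreover, for every $N\ge1$, $$F_N(q)=\frac{1}{(q)_N}\,\widehat F^{(N)}_0(q)\,\bigl(1+r_N(q)\bigr).$$
   Context: The polynomials $\widehat F^{(n)}_0(q),\widehat F^{(n)}_1(q)$ ($n\ge0$) are defined by $\widehat F^{(0)}_0=1$, $\widehat F^{(0)}_1=0$ and, for $n\ge1$, $\widehat F^{(n)}_0=\widehat F^{(n-1)}_0+q^n\widehat F^{(n-1)}_1$, $\widehat F^{(n)}_1=q^n\widehat F^{(n-1)}_0+(1-q^n)\widehat F^{(n-1)}_1$. Quotients are taken in the field of rational functions in $q$. Let $(q)_N=\prod_{j=1}^N(1-q^j)$ and $$M_j(q)=\begin{pmatrix}\frac{1}{1-q^j}&\frac{q^j}{1-q^j}\\ \frac{q^j}{1-q^j}&1\end{pmatrix}.$$ The finite truncation $F_N(q)$ is $$F_N(q)=\begin{pmatrix}1&0\end{pmatrix}\bigl(M_1(q)M_2(q)\cdots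 M_N(q)\bigr)\begin{pmatrix}1\\1\end{pmatrix}.$$ *)

(* Defs.v *)
From mathcomp Require Import all_boot all_order all_algebra.

Set Implicit Arguments.
Unset Strict Implicit.
Unset Printing Implicit Defensive.

Import GRing.Theory.
Local Open Scope ring_scope.

Notation Qq := {fraction {poly rat}}.

Definition q : Qq := tofrac ('X : {poly rat}).

Fixpoint Fhat (n : nat) : {poly rat} * {poly rat} :=
  if n is m.+1 then
    let: (F0, F1) := Fhat m in
    (F0 + 'X^n * F1, 'X^n * F0 + (1 - 'X^n) * F1)
  else (1, 0).

Definition Fhat0 (n : nat) : {poly rat} := (Fhat n).1.
Definition Fhat1 (n : nat) : {poly rat} := (Fhat n).2.

Definition r (n : nat) : Qq := tofrac (Fhat1 n) / tofrac (Fhat0 n).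

Definition G (n : nat) (x : Qq) : Qq :=
  (q ^+ n + (1 - q ^+ n) * x) / (1 + q ^+ n * x).

(* G_n (G_(n-1) (... G_2 (q / 1) ...)); for n = 1 no G is applied and the value
   is q / 1. Only meaningful for n >= 1. *)
Definition nested (n : nat) : Qq :=
  foldl (fun x k => G k x) (q / 1) (iota 2 n.-1).

Definition qpoch (N : nat) : Qq := \prod_(1 <= j < N.+1) (1 - q ^+ j).

Definition mx22 (a b c d : Qq) : 'M[Qq]_2 :=
  \matrix_(i < 2, j < 2)
    if i == 0 then (if j == 0 then a else b) else (if j == 0 then c else d).

Definition M (j : nat) : 'M[Qq]_2 :=
  mx22 (1 / (1 - q ^+ j))      (q ^+ j / (1 - q ^+ j))
       (q ^+ j / (1 - q ^+ j)) 1.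

(* \prod in the (noncommutative) ring of 2 x 2 matrices multiplies from left to
   right in increasing order of j. *)
Definition FN (N : nat) : Qq :=
  ((\row_(j < 2) (if j == 0 then 1 else 0))
     *m (\prod_(1 <= j < N.+1) M j)
     *m (\col_(i < 2) 1)) 0 0.

(* Main.v *)
Require Import Defs.
From mathcomp Require Import all_boot all_order all_algebra.
From mathcomp Require Import ring.

Import GRing.Theory.
Local Open Scope ring_scope.

(** The matrix [T_j = (1 - q^j) M_j] is the one-step matrix of the recurrence
    for the column vector [(Fhat0, Fhat1)].  Since each [T_j] is symmetric,
    transposing [T_N ... T_1 (1, 0)^T] shows that the row vector
    [(1, 0) M_1 ... M_N] is [(Fhat0 N, Fhat1 N) / (q)_N].  The denominators are
    nonzero because the polynomials involved take the value 1 at [q = 0]; the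
    denominator of [G_n] at [r_(n-1)] is [Fhat0 n / Fhat0 (n-1)]. *)

(** These identities are stated over an abstract field because [field] runs
    away unfolding the concrete type of fractions; inferring their arguments
    there by unification has the same problem. *)
Lemma fracG (K : fieldType) (a b c x : K) : a != 0 -> c != 0 ->
  (x * a + (1 - x) * b) / c = (x + (1 - x) * (b / a)) / (c / a).
Proof. by move=> a0 c0; field; rewrite a0 c0. Qed.

Lemma row_step0 (K : fieldType) (a b p x : K) : p != 0 -> 1 - x != 0 ->
  a / p * (1 / (1 - x)) + b / p * (x / (1 - x)) = (a + x * b) / (p * (1 - x)).
Proof. by move=> p0 x1; field; rewrite p0 x1. Qed.

Lemma row_step1 (K : fieldType) (a b p x : K) : p != 0 -> 1 - x != 0 ->
  a / p * (x / (1 - x)) + b / p * 1 = (x * a + (1 - x) * b) / (p * (1 - x)).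
Proof. by move=> p0 x1; field; rewrite p0 x1. Qed.

Lemma row_sum (K : fieldType) (a b p : K) : p != 0 -> a != 0 ->
  a / p * 1 + b / p * 1 = 1 / p * a * (1 + b / a).
Proof. by move=> p0 a0; field; rewrite p0 a0. Qed.

Lemma Fhat0S (n : nat) : Fhat0 n.+1 = Fhat0 n + 'X^(n.+1) * Fhat1 n.
Proof. by rewrite /Fhat0 /Fhat1 /=; case: (Fhat n). Qed.

Lemma Fhat1S (n : nat) :
  Fhat1 n.+1 = 'X^(n.+1) * Fhat0 n + (1 - 'X^(n.+1)) * Fhat1 n.
Proof. by rewrite /Fhat0 /Fhat1 /=; case: (Fhat n). Qed.

(** At 0 the positive power of ['X] kills the [Fhat1] term of the recurrence, so the constant term
    of [Fhat0] never changes. *)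
Lemma Fhat0_horner0 (n : nat) : (Fhat0 n).[0] = 1.
Proof.
elim: n => [|n IHn]; first by rewrite hornerC.
by rewrite Fhat0S !hornerE IHn /= ?expr0n ?mul0r ?addr0.
Qed.

Lemma tofrac_neq0_horner0 (p : {poly rat}) :
  p.[0] = 1 -> tofrac p != 0.
Proof.
move=> p1; rewrite tofrac_eq0; apply/eqP => p0.
by move/eqP: p1; rewrite p0 horner0 eq_sym oner_eq0.
Qed.

Lemma tofrac_Fhat0_neq0 (n : nat) : tofrac (Fhat0 n) != 0.
Proof. exact/tofrac_neq0_horner0/Fhat0_horner0. Qed.

Lemma subr1_qX_neq0 (n : nat) : 1 - q ^+ n.+1 != 0.
Proof.
rewrite /q -rmorphXn -[1](rmorph1 (@tofrac {poly rat})) -rmorphB.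
by apply: tofrac_neq0_horner0; rewrite !hornerE /= ?expr0n ?subr0.
Qed.

Lemma qpochS (N : nat) : qpoch N.+1 = qpoch N * (1 - q ^+ N.+1).
Proof. by rewrite /qpoch big_nat_recr. Qed.

Lemma qpoch_neq0 (N : nat) : qpoch N != 0.
Proof.
elim: N => [|N IHN]; first by rewrite /qpoch big_geq ?oner_eq0.
by rewrite qpochS mulf_neq0 ?subr1_qX_neq0.
Qed.

Lemma tofrac_Fhat0S (n : nat) :
  tofrac (Fhat0 n.+1) = tofrac (Fhat0 n) + q ^+ n.+1 * tofrac (Fhat1 n).
Proof. by rewrite Fhat0S rmorphD rmorphM rmorphXn. Qed.

Lemma tofrac_Fhat1S (n : nat) :
  tofrac (Fhat1 n.+1) =
  q ^+ n.+1 * tofrac (Fhat0 n) + (1 - q ^+ n.+1) * tofrac (Fhat1 n).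
Proof.
by rewrite Fhat1S rmorphD !rmorphM rmorphB rmorph1 rmorphXn.
Qed.

Lemma denomG_r (n : nat) :
  1 + q ^+ n.+1 * r n = tofrac (Fhat0 n.+1) / tofrac (Fhat0 n).
Proof.
by rewrite tofrac_Fhat0S /r mulrDl mulrA divff ?tofrac_Fhat0_neq0.
Qed.

Lemma denomG_r_neq0 (n : nat) : 1 + q ^+ n.+1 * r n != 0.
Proof. by rewrite denomG_r mulf_neq0 ?invr_eq0 ?tofrac_Fhat0_neq0. Qed.

Lemma r0 : r 0 = 0.
Proof. by rewrite /r rmorph0 mul0r. Qed.

Lemma rS (n : nat) : r n.+1 = G n.+1 (r n).
Proof.
(* Only the numerator [Fhat1 n.+1] is expanded; dividing it and [Fhat0 n.+1] by [Fhat0 n] gives the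
   numerator and denominator of [G]. *)
rewrite /G denomG_r {1}/r tofrac_Fhat1S /r.
exact: (@fracG _ (tofrac (Fhat0 n)) (tofrac (Fhat1 n)) (tofrac (Fhat0 n.+1))
          (q ^+ n.+1) (tofrac_Fhat0_neq0 n) (tofrac_Fhat0_neq0 n.+1)).
Qed.

Lemma G1_0 : G 1 0 = q / 1.
Proof. by rewrite /G !mulr0 !addr0 expr1. Qed.

Lemma r1 : r 1 = q.
Proof. by rewrite rS r0 G1_0 divr1. Qed.

Lemma nestedS (n : nat) : nested n.+2 = G n.+2 (nested n.+1).
(* The range splits as [iota 2 n] followed by the single index [n.+2], which [foldl] applies last,
   hence outermost. *)
Proof. by rewrite /nested -[n.+2.-1]addn1 iotaD foldl_cat. Qed.

Lemma r_nested (n : nat) : r n.+1 = nested n.+1.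
Proof.
elim: n => [|n IHn]; first by rewrite r1 /nested /= divr1.
by rewrite nestedS rS IHn.
Qed.

(** Each induction step appends [M N.+1] on the right: its two columns, scaled by [1 - q ^+ N.+1],
    hold the coefficients of the recurrences for [Fhat0] and [Fhat1]. *)
Lemma row_prod_M (N : nat) :
  (\row_(j < 2) (if j == 0 then 1 else 0)) *m (\prod_(1 <= j < N.+1) M j) =
  \row_(j < 2) ((if j == 0 then tofrac (Fhat0 N) else tofrac (Fhat1 N))
                  / qpoch N).
Proof.
elim: N => [|N IHN].
  rewrite big_geq // mulmx1 /qpoch big_geq //.
  by apply/rowP => j; rewrite !mxE divr1 rmorph1 rmorph0.
rewrite big_nat_recr //= -mulmxE mulmxA IHN.
have qN := qpoch_neq0 N; have qS := subr1_qX_neq0 N.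
apply/rowP => j; rewrite !mxE !big_ord_recl big_ord0 !mxE /= qpochS.
rewrite tofrac_Fhat0S tofrac_Fhat1S.
case: ifP => _; rewrite addr0.
- exact: (@row_step0 _ (tofrac (Fhat0 N)) (tofrac (Fhat1 N)) (qpoch N)
            (q ^+ N.+1) qN qS).
- exact: (@row_step1 _ (tofrac (Fhat0 N)) (tofrac (Fhat1 N)) (qpoch N)
            (q ^+ N.+1) qN qS).
Qed.

(** The column of ones adds the two entries of the row; factoring out [Fhat0 N] leaves [1 + r N]. *)
Lemma FN_Fhat (N : nat) :
  FN N = 1 / qpoch N * tofrac (Fhat0 N) * (1 + r N).
Proof.
have qN := qpoch_neq0 N; have F0 := tofrac_Fhat0_neq0 N.
rewrite /FN row_prod_M !mxE !big_ord_recl big_ord0 !mxE /= /r.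
rewrite addr0.
exact: (@row_sum _ (tofrac (Fhat0 N)) (tofrac (Fhat1 N)) (qpoch N) qN F0).
Qed.

Theorem proposition6 :
  (* well-definedness of the quotients *)
  [/\ forall n : nat, tofrac (Fhat0 n) != 0,
      forall n : nat, (1 <= n)%N -> 1 + q ^+ n * r n.-1 != 0
    & forall N : nat, qpoch N != 0] /\
  (* linear-fractional recurrence *)
  (r 0 = 0 /\ forall n : nat, (1 <= n)%N -> r n = G n (r n.-1)) /\
  (* nested continued fraction *)
  [/\ q / 1 = G 1 0, r 1 = q
    & forall n : nat, (1 <= n)%N -> r n = nested n] /\
  (* finite truncation *)
  (forall N : nat, (1 <= N)%N ->
     FN N = 1 / qpoch N * tofrac (Fhat0 N) * (1 + r N)).
Proof.
split; first split.
- exact: tofrac_Fhat0_neq0.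
- by case=> // n _; apply: denomG_r_neq0.
- exact: qpoch_neq0.
split; first by split=> [|[|n] // _]; [exact: r0 | exact: rS].
split; last by move=> N _; apply: FN_Fhat.
split; [by rewrite G1_0 | exact: r1 |].
by case=> // n _; apply: r_nested.
Qed.
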